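(* Suppose that $F/\mathbb{F}_q$ is an $(m,n)$-friendly algebraic function field, with associated place $Q$ and functions $z_1,z_2$. Let $f_i=z_1^{i-1}$ for $i=1,\dots,m$ and $g_j=z_2^{j-1}$ for $j=1,\dots,n$. Then the functions $$f:=\sum_{i=1}^m A_if_i,\qquad g:=\sum_{j=1}^n B_jg_j$$ satisfy $$v_Q(f_ig_j)\ne v_Q(f_{i'}g_{j'})\quad\text{if }(i,j)\ne(i',j').$$ Consequently, they form a polynomial AG code with recovery threshold $R=g(F)+mn$.
   Context: Here $q$ is a prime power and $F/\mathbb{F}_q$ is an algebraic function field, i.e. a finite extension of $\mathbb{F}_q(x)$ with $x$ transcendental over $\mathbb{F}_q$, of genus $g(F)$; $v_P$ is the discrete valuation at a place $P$, and $(z)_\infty$ is the pole divisor of $z$. Definition. An $(m,n)$-friendly algebraic function field is a function field $F/\mathbb{F}_q$ with a place $Q$ of $F/\mathbb{F}_q$ such that: (1) the genus satisfies $(m-1)\mid g(F)$; (2) there exists $z_1\in F$ with $v_Q(z_1)=1$ and $\deg((z_1)_\infty)=\frac{g(F)}{m-1}+1$; (3) there exists $z_2$ such that $(z_2)_\infty=mQ$. Polynomial AG code: matrices $A\in\mathbb{F}_q^{r\times s}$ and $B\in\mathbb{F}_q^{s\times t}$, where $m\mid r$ and $n\mid t$, are partitioned into row blocks $A_1,\dots,A_m$ of $A$ (each of size $\frac rm\times s$) and column blocks $B_1,\dots,B_n$ of $B$ (each of size $s\times\frac tn$). One chooses linearly independent sets of functions $\{f_1,\dots,f_m\}$ and $\{g_1,\dots,g_n\}$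 in $\mathcal{L}(\infty G)=\bigcup_{k\in\mathbb{N}}\mathcal{L}(kG)$ for a divisor $G$ of $F/\mathbb{F}_q$ (where $\mathcal{L}(kG)$ is the Riemann-Roch space of $kG$), such that $v_Q(f_ig_j)\ne v_Q(f_{i'}g_{j'})$ whenever $(i,j)\ne(i',j')$ (this ensures that the $mn$ functions $f_ig_j$ are linearly independent), and puts $f=\sum_i A_if_i$, $g=\sum_j B_jg_j$, $h=fg=\sum_{i,j}A_iB_jf_ig_j$. Worker nodes return values $h(P)=f(P)g(P)$ at places $P$ of $F$ outside the support of $G$. The recovery threshold $R$ is the minimum number of worker responses needed to recover $h$ (and hence $AB$), and is given by $R=\deg((h)_\infty)+1$.
   Formalization: The recovery threshold R = g(F)+mn is proved assuming deg Q = 1 (it fails for places Q of higher degree when n > 1), with (h)_∞ taken as the least divisor bounding the poles of h for all matrices A, B (for a fixed pair such as A = 0 the formula fails). *)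

(* Defs.v *)
From HB Require Import structures.
From mathcomp Require Import all_boot all_order all_algebra all_field.
From mathcomp Require Import boolp classical_sets functions cardinality fsbigop.
From mathcomp Require Import constructive_ereal freeg.

Set Implicit Arguments.
Unset Strict Implicit.
Unset Printing Implicit Defensive.
Import Order.TTheory GRing.Theory Num.Theory.
Local Open Scope ring_scope.

(* K is the finite field F_q.  A function field F/F_q is a finite extension of
   the field K(x) = {fraction {poly K}}.  Nothing below depends on the choice
   of x: only the embedding of K and the field structure of F are used. *)
Notation functionFieldType K := (fieldExtType {fraction {poly K}}).

Section FunctionField.
Variables (K : finFieldType) (F : functionFieldType K).

Definition const_emb : K -> F :=
  in_alg F \o (@tofrac {poly K} \o @polyC K).
HB.instance Definition _ := GRing.RMorphism.on const_emb.

(* The places of F/K are identified with the normalized discrete valuations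
   v_P of F that are trivial on K. *)
Record place := Place {
  val_at :> F -> \bar int;
  val_at_eqy : forall x, val_at x = +oo%E <-> x = 0;
  val_atM : forall x y, val_at (x * y) = (val_at x + val_at y)%E;
  val_atD : forall x y,
    (Order.min (val_at x) (val_at y) <= val_at (x + y))%E;
  val_at_cst : forall c, c != 0 -> val_at (const_emb c) = 0%E;
  val_at_surj : exists t, val_at t = 1%E }.

HB.instance Definition _ := gen_eqMixin place.
HB.instance Definition _ := gen_choiceMixin place.

(* [is_reldim V W d]: the K-vector space V / W has dimension d
   (for K-subspaces W of V of F). *)
Definition is_reldim (V W : set F) (d : nat) :=
  exists2 b : 'I_d -> F, (forall i, V (b i)) &
    forall x, V x ->
      exists! c : {ffun 'I_d -> K}, W (x - \sum_i const_emb (c i) * b i).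

Definition reldim (V W : set F) : nat := xget 0%N (is_reldim V W).

Definition valuation_ring (P : place) : set F :=
  [set x | (0 <= P x)%E]%classic.
Definition maximal_ideal (P : place) : set F :=
  [set x | (0 < P x)%E]%classic.

Definition place_degree (P : place) : nat :=
  reldim (valuation_ring P) (maximal_ideal P).

Definition divisor := {freeg place / int}.

Definition divisor_degree (D : divisor) : int :=
  \sum_(P <- dom D) coeff P D * (place_degree P)%:Z.

Definition riemann_roch (D : divisor) : set F :=
  [set x | forall P : place, ((- coeff P D)%:E <= P x)%E]%classic.

Definition ell (D : divisor) : nat := reldim (riemann_roch D) [set 0]%classic.

Definition genus : nat := xget 0%N
  [set g : nat |
     (exists D : divisor, divisor_degree D - (ell D)%:Z + 1 = g%:Z) /\
     (forall D : divisor, divisor_degree D - (ell D)%:Z + 1 <= g%:Z)]%classic.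

Definition pole_order (P : place) (x : F) : int :=
  fine (Order.max 0%E (- P x)%E).

(* A sum over P \in A runs over the support of its general term (and is 0 if
   that support is infinite); a function x has only finitely many poles. *)
Definition pole_divisor (x : F) : divisor :=
  \sum_(P \in [set: place]%classic) << pole_order P x *g P >>.

Definition linearly_independent (n : nat) (f : 'I_n -> F) :=
  forall c : 'I_n -> K, \sum_i const_emb (c i) * f i = 0 -> forall i, c i = 0.

(* Only the pole number m enters the conditions; n is part of the name. *)
Definition friendly (m n : nat) (Q : place) (z1 z2 : F) :=
  [/\ (m.-1 %| genus)%N,
      Q z1 = 1%E,
      divisor_degree (pole_divisor z1) = (genus %/ m.-1 + 1)%N%:Z
    & pole_divisor z2 = << m%:Z *g Q >>].

(* L(oo G), the union of the L(kG) *)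
Definition riemann_roch_infty (G : divisor) : set F :=
  [set x | exists k : nat, riemann_roch (G *+ k) x]%classic.

Definition distinct_valuations (m n : nat) (Q : place)
    (f : 'I_m -> F) (g : 'I_n -> F) :=
  forall i j i' j', (i, j) <> (i', j') -> Q (f i * g j) <> Q (f i' * g j').

Definition polynomial_AG_code (m n : nat) (Q : place)
    (f : 'I_m -> F) (g : 'I_n -> F) :=
  [/\ exists G : divisor,
        (forall i, riemann_roch_infty G (f i)) /\
        (forall j, riemann_roch_infty G (g j)),
      linearly_independent f,
      linearly_independent g
    & distinct_valuations Q f g].

End FunctionField.

Lemma block_idx_subproof (m r : nat) (mr : (m %| r)%N)
    (i : 'I_m) (k : 'I_(r %/ m)) : (i * (r %/ m) + k < r)%N.
Proof.
rewrite -[X in (_ < X)%N](divnK mr) mulnC [(r %/ m * m)%N]mulnC mulnC.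
apply: (@leq_trans (i.+1 * (r %/ m))%N); last by rewrite leq_mul2r ltn_ord orbT.
by rewrite mulSn addnC ltn_add2r ltn_ord.
Qed.

Definition block_idx (m r : nat) (mr : (m %| r)%N)
    (i : 'I_m) (k : 'I_(r %/ m)) : 'I_r := Ordinal (block_idx_subproof mr i k).

Definition row_block (K : Type) (m r s : nat) (mr : (m %| r)%N)
    (A : 'M[K]_(r, s)) (i : 'I_m) : 'M[K]_(r %/ m, s) :=
  rowsub (block_idx mr i) A.

Definition col_block (K : Type) (n s t : nat) (nt : (n %| t)%N)
    (B : 'M[K]_(s, t)) (j : 'I_n) : 'M[K]_(s, t %/ n) :=
  colsub (block_idx nt j) B.

Section RecoveryThreshold.
Variables (K : finFieldType) (F : functionFieldType K).
Variables (m n r s t : nat) (mr : (m %| r)%N) (nt : (n %| t)%N).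
Variables (f : 'I_m -> F) (g : 'I_n -> F).

Definition code_f (A : 'M[K]_(r, s)) : 'M[F]_(r %/ m, s) :=
  \sum_i f i *: map_mx (const_emb F) (row_block mr A i).

Definition code_g (B : 'M[K]_(s, t)) : 'M[F]_(s, t %/ n) :=
  \sum_j g j *: map_mx (const_emb F) (col_block nt B j).

Definition code_h (A : 'M[K]_(r, s)) (B : 'M[K]_(s, t)) :
  'M[F]_(r %/ m, t %/ n) := code_f A *m code_g B.

(* The threshold belongs to the code, so it must serve every input (A, B):
   (h)_oo is the least divisor bounding the poles of all entries of h for all
   A and B.  (For special inputs, such as A = 0, h has fewer poles.) *)
Definition code_pole_order (P : place F) : int :=
  \big[Order.max/0]_(A : 'M[K]_(r, s)) \big[Order.max/0]_(B : 'M[K]_(s, t))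
    \big[Order.max/0]_k \big[Order.max/0]_l pole_order P (code_h A B k l).

Definition code_pole_divisor : divisor F :=
  \sum_(P \in [set: place F]%classic) << code_pole_order P *g P >>.

Definition recovery_threshold : int := divisor_degree code_pole_divisor + 1.

End RecoveryThreshold.

Arguments recovery_threshold {K F m n r} s {t} mr nt f g.

(* Main.v *)
(* v_Q(z1^i z2^j) = i - m j with 0 <= i < m, so Euclidean division by m recovers
   (i, j) from the valuation.  The pole order of the code at any place P is that
   of z1^(m-1) z2^(n-1) computed factorwise, since no place is a pole of both z1
   and z2; hence (h)_oo = (m-1)(z1)_oo + (n-1)(z2)_oo, whose degree is
   (m-1)(g/(m-1) + 1) + (n-1)m = g + mn - 1 when deg Q = 1. *)
Require Import Defs.
From HB Require Import structures.
From mathcomp Require Import all_boot all_order all_algebra all_field.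
From mathcomp Require Import boolp classical_sets functions cardinality fsbigop.
From mathcomp Require Import constructive_ereal freeg.

Set Implicit Arguments.
Unset Strict Implicit.
Unset Printing Implicit Defensive.
Import Order.TTheory GRing.Theory Num.Theory.
Local Open Scope ring_scope.

(** * Valuations at a place and truncated pole orders *)

Section Valuations.
Variables (K : finFieldType) (F : functionFieldType K) (P : place F).

Lemma val_at0 : P 0 = +oo%E.
Proof. exact/val_at_eqy. Qed.

Lemma val_at1 : P 1 = 0%E.
Proof. by rewrite -(rmorph1 (const_emb F)) val_at_cst ?oner_neq0. Qed.

Lemma val_at_fin x : x != 0 -> exists a : int, P x = a%:E.
Proof.
move=> x0; have := val_at1; rewrite -(divff x0) val_atM.
case Px: (P x) => [a| |]; first by exists a.
- by move/val_at_eqy: Px x0 => ->; rewrite eqxx.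
(* A sum starting with [-oo] is [-oo] whatever the other summand is, so it cannot be 0. *)
- by case: (P _).
Qed.

Lemma val_atX x (a : int) k : P x = a%:E -> P (x ^+ k) = (a *+ k)%:E.
Proof.
move=> Px; elim: k => [|k IHk]; first by rewrite expr0 val_at1.
by rewrite exprS val_atM Px IHk mulrS.
Qed.

Lemma val_at_const_ge0 c : (0 <= P (const_emb F c))%E.
Proof.
have [->|c0] := eqVneq c 0; first by rewrite rmorph0 val_at0.
by rewrite val_at_cst.
Qed.

Lemma val_at_constM c x : c != 0 -> P (const_emb F c * x) = P x.
Proof. by move=> c0; rewrite val_atM val_at_cst // add0e. Qed.

Lemma val_atN x : P (- x) = P x.
Proof.
rewrite -mulN1r -(rmorphN1 (const_emb F)) val_at_constM //.
by rewrite oppr_eq0 oner_neq0.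
Qed.

Lemma val_at_sum_ge I (r : seq I) (p : pred I) (x : I -> F) a :
  (forall i, p i -> (a <= P (x i))%E) -> (a <= P (\sum_(i <- r | p i) x i)%R)%E.
Proof.
move=> ax; elim/big_ind: _ => [|y z ay az|//]; first by rewrite val_at0 leey.
by apply: le_trans (val_atD _ _ _); rewrite le_min ay.
Qed.

(** The bound is an integer because the empty sum has valuation [+oo], which is strictly larger only
    than a bound other than [+oo]. *)
Lemma val_at_sum_gt I (r : seq I) (p : pred I) (x : I -> F) (a : int) :
  (forall i, p i -> (a%:E < P (x i))%E) ->
  (a%:E < P (\sum_(i <- r | p i) x i)%R)%E.
Proof.
move=> ax; elim/big_ind: _ => [|y z ay az|//]; first by rewrite val_at0 ltry.
by apply: lt_le_trans (val_atD _ _ _); rewrite lt_min ay.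
Qed.

(** In a vanishing combination, the term of least valuation among those with nonzero coefficient
    would be minus the sum of the others, whose valuation is strictly larger. *)
Lemma val_inj_linearly_independent n (f : 'I_n -> F) :
  (forall i, f i != 0) -> injective (fun i => P (f i)) ->
  linearly_independent f.
Proof.
move=> f0 f_inj c sum0 i; apply: contraTeq isT => ci.
case: (@arg_minP _ _ _ i (fun j => c j != 0) (fun j => P (f j)) ci).
move=> j cj jmin.
have [a Pa] := val_at_fin (f0 j).
have /eqP := sum0; rewrite (bigD1 j) //= addr_eq0 => /eqP eqj.
have: (a%:E < P (- \sum_(i < n | i != j) const_emb F (c i) * f i)%R)%E.
  rewrite val_atN; apply: val_at_sum_gt => k kj.
  have [->|ck] := eqVneq (c k) 0; first by rewrite rmorph0 mul0r val_at0 ltry.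
  rewrite val_at_constM // lt_neqAle -Pa jmin // andbT.
  by apply: contraNneq kj => /f_inj ->.
by rewrite -eqj val_at_constM // Pa ltxx.
Qed.

Lemma pole_order_ge0 x : 0 <= pole_order P x.
Proof.
rewrite /pole_order; have [->|/val_at_fin[a ->]] := eqVneq x 0.
  by rewrite val_at0.
by rewrite -EFinN -EFin_max /= le_max lexx.
Qed.

Lemma pole_orderE x (a : int) : P x = a%:E -> pole_order P x = Num.max 0 (- a).
Proof. by rewrite /pole_order => ->; rewrite -EFinN -EFin_max. Qed.

(** Pole orders are truncated at 0, so only nonnegative bounds translate into valuation bounds. The
    case [x = 0] fits in, with pole order 0 and valuation [+oo]. *)
Lemma pole_order_leP x b :
  0 <= b -> (pole_order P x <= b) = ((- b)%:E <= P x)%E.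
Proof.
move=> b0; have [->|/val_at_fin[a Pa]] := eqVneq x 0.
  by rewrite /pole_order val_at0 /= b0 leey.
by rewrite (pole_orderE Pa) Pa ge_max b0 lee_fin lerNl.
Qed.

Lemma val_at_ge_pole_order x : ((- pole_order P x)%:E <= P x)%E.
Proof. by rewrite -pole_order_leP ?pole_order_ge0. Qed.

Lemma val_atM_ge x y (a b : int) :
  (a%:E <= P x)%E -> (b%:E <= P y)%E -> ((a + b)%:E <= P (x * y)%R)%E.
Proof. by move=> ax bx; rewrite val_atM EFinD leeD. Qed.

Lemma pole_order_exp_le x k : pole_order P (x ^+ k) <= pole_order P x *+ k.
Proof.
rewrite pole_order_leP ?mulrn_wge0 ?pole_order_ge0 // -mulNrn.
elim: k => [|k IHk]; first by rewrite expr0 val_at1.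
by rewrite exprS mulrS val_atM_ge ?val_at_ge_pole_order.
Qed.

End Valuations.

(** * Additivity of the degree, and divisors given by their orders at all places *)

Section Divisors.
Variables (K : finFieldType) (F : functionFieldType K).
Implicit Types (D : divisor F) (P Q : place F).

(** The degree as the linear extension of [place_degree] to the free group on the places, from which
    additivity is inherited; [int^o] is [int] as a module over itself. *)
Let degree_lift : {freeg (place F) / int} -> int^o :=
  fglift (fun P => (place_degree P)%:Z : int^o).

HB.instance Definition _ :=
  GRing.isZmodMorphism.Build _ _ degree_lift (lift_is_additive _).

Lemma divisor_degree_lift D : divisor_degree D = degree_lift D.
Proof.
rewrite -[in RHS](freeg_sumE D) raddf_sum /=.
by apply: eq_bigr => P _; rewrite /degree_lift liftU.
Qed.

Lemma divisor_degreeD D1 D2 :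
  divisor_degree (D1 + D2) = divisor_degree D1 + divisor_degree D2.
Proof. by rewrite !divisor_degree_lift raddfD. Qed.

Lemma divisor_degreeMn D k : divisor_degree (D *+ k) = divisor_degree D *+ k.
Proof.
elim: k => [|k IHk]; first by rewrite /divisor_degree dom0 big_nil.
by rewrite !mulrS divisor_degreeD IHk.
Qed.

Lemma divisor_degreeU k P :
  divisor_degree << k *g P >> = k * (place_degree P)%:Z.
Proof. by rewrite divisor_degree_lift /degree_lift liftU. Qed.

(** Agreement with the coefficients of [D] gives [d] finite support, so the sum over all places is a
    genuine finite sum over [dom D]. *)
Lemma fsum_divisorE (d : place F -> int) D :
  (forall P, d P = coeff P D) ->
  \sum_(P \in [set: place F]%classic) << d P *g P >> = D.
Proof.
move=> dE; rewrite (@fsbigE _ _ _ _ _ (dom D)) ?uniq_dom //; last first.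
  move=> P _ /coeff_outdom; rewrite dE => ->.
  by apply/eqP/freeg_eqP => R; rewrite coeffU mul0r coeff0.
rewrite -[RHS](freeg_sumE D) big_mkcond /=; apply: eq_bigr => P _.
by rewrite in_setT dE.
Qed.

(* An infinite support makes the sum 0 by convention, which is excluded. *)
Lemma coeff_fsum_divisor (d : place F -> int) :
  let D := \sum_(P \in [set: place F]%classic) << d P *g P >> in
  D != 0 -> forall P, coeff P D = d P.
Proof.
move=> D D0 P.
pose S := [set P : place F | << d P *g P >> <> 0 :> divisor F]%classic.
have finS : finite_set S.
  apply: contrapT => infS; move/eqP: D0; apply; apply: fsbig_dflt.
  by rewrite setTI.
have dS R : ~ S R -> d R = 0.
  move=> /contrapT/(congr1 (coeff R)); rewrite coeffU eqxx mulr1 => ->.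
  exact: coeff0.
rewrite /D -(fsbig_widen S) //; last first.
  by move=> R [_ /= /contrapT].
rewrite fsbig_finite //= raddf_sum /=.
rewrite (eq_bigr (fun R => if R == P then d R else 0)); last first.
  by move=> R _; rewrite coeffU; case: eqP => _; rewrite ?mulr1 ?mulr0.
rewrite -big_mkcond /=; case: (pselect (S P)) => [SP|NSP].
  rewrite (big_rem P) /= ?in_fset_set ?mem_set // eqxx big_seq_cond.
  rewrite big1 ?addr0 // => R /andP[+ /eqP RP].
  by rewrite mem_rem_uniq ?finmap.fset_uniq // RP inE eqxx.
by rewrite big1 ?dS // => R /eqP ->; exact: dS.
Qed.

Lemma coeff_pole_divisor (x : F) P :
  pole_divisor x != 0 -> coeff P (pole_divisor x) = pole_order P x.
Proof. by move/coeff_fsum_divisor. Qed.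

End Divisors.

(** * Blocks of elementary matrices and pole orders of the code *)

Lemma row_block_delta (R : pzRingType) m r s (mr : (m %| r)%N)
    (i i0 : 'I_m) (k0 : 'I_(r %/ m)) (x0 x : 'I_s) :
  row_block mr (delta_mx (block_idx mr i0 k0) x0) i k0 x =
    ((i == i0) && (x == x0))%:R :> R.
Proof.
(* The mere existence of [k0] makes the block height positive, hence cancellable when row indices
   are compared. *)
have rm_gt0 : (0 < r %/ m)%N by apply: leq_ltn_trans (ltn_ord k0).
by rewrite !mxE -!val_eqE /= eqn_add2r eqn_pmul2r.
Qed.

Lemma col_block_delta (R : pzRingType) n s t (nt : (n %| t)%N)
    (j j0 : 'I_n) (l0 : 'I_(t %/ n)) (x0 x : 'I_s) :
  col_block nt (delta_mx x0 (block_idx nt j0 l0)) j x l0 =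
    ((x == x0) && (j == j0))%:R :> R.
Proof.
have tn_gt0 : (0 < t %/ n)%N by apply: leq_ltn_trans (ltn_ord l0).
by rewrite !mxE -!val_eqE /= eqn_add2r eqn_pmul2r.
Qed.

Section Code.
Variables (K : finFieldType) (F : functionFieldType K).
Variables (m n r s t : nat) (mr : (m %| r)%N) (nt : (n %| t)%N).
Variables (f : 'I_m -> F) (g : 'I_n -> F).

Lemma code_fE A k (x : 'I_s) :
  code_f mr f A k x = \sum_i f i * const_emb F (row_block mr A i k x).
Proof. by rewrite /code_f summxE; apply: eq_bigr => i _; rewrite 2!mxE. Qed.

Lemma code_gE B (x : 'I_s) l :
  code_g nt g B x l = \sum_j g j * const_emb F (col_block nt B j x l).
Proof. by rewrite /code_g summxE; apply: eq_bigr => j _; rewrite 2!mxE. Qed.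

(** Elementary matrices isolate a single product, so each [f i * g j] occurs as an entry of [h] for
    some input; this yields the lower bound on the pole order of the code. *)
Lemma code_h_delta i j k l (x : 'I_s) :
  code_h mr nt f g (delta_mx (block_idx mr i k) x)
    (delta_mx x (block_idx nt j l)) k l = f i * g j.
Proof.
have fE y : code_f mr f (delta_mx (block_idx mr i k) x) k y = f i *+ (y == x).
  rewrite code_fE (bigD1 i) //= row_block_delta eqxx rmorph_nat mulr_natr.
  rewrite big1 ?addr0 // => i' /negbTE i'i.
  by rewrite row_block_delta i'i rmorph0 mulr0.
have gE : code_g nt g (delta_mx x (block_idx nt j l)) x l = g j.
  rewrite code_gE (bigD1 j) //= col_block_delta !eqxx rmorph1 mulr1.
  rewrite big1 ?addr0 // => j' /negbTE j'j.
  by rewrite col_block_delta j'j andbF rmorph0 mulr0.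
rewrite mxE (bigD1 x) //= fE eqxx gE big1 ?addr0 // => y /negbTE yx.
by rewrite fE yx mul0r.
Qed.

Hypotheses (r_gt0 : (0 < r)%N) (s_gt0 : (0 < s)%N) (t_gt0 : (0 < t)%N).

Lemma pole_order_le_code (P : place F) i j :
  pole_order P (f i * g j) <= code_pole_order s mr nt f g P.
Proof.
have m_gt0 : (0 < m)%N := dvdn_gt0 r_gt0 mr.
have n_gt0 : (0 < n)%N := dvdn_gt0 t_gt0 nt.
have rm_gt0 : (0 < r %/ m)%N by rewrite divn_gt0 // dvdn_leq.
have tn_gt0 : (0 < t %/ n)%N by rewrite divn_gt0 // dvdn_leq.
pose k := Ordinal rm_gt0; pose l := Ordinal tn_gt0; pose x := Ordinal s_gt0.
rewrite -(code_h_delta i j k l x) /code_pole_order.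
apply: (bigmax_sup (delta_mx (block_idx mr i k) x)) => //.
apply: (bigmax_sup (delta_mx x (block_idx nt j l))) => //.
by apply: (bigmax_sup k) => //; exact: le_bigmax.
Qed.

(** Constants have nonnegative valuation, so by the ultrametric inequality the bounds pass to the
    entries of [f] and [g] and add up in those of [h]. Nonnegativity of [a + b] covers the initial
    value 0 of the maxima. *)
Lemma code_pole_order_le (P : place F) (a b : int) : 0 <= a -> 0 <= b ->
  (forall i, pole_order P (f i) <= a) -> (forall j, pole_order P (g j) <= b) ->
  code_pole_order s mr nt f g P <= a + b.
Proof.
move=> a0 b0 fa gb; have ab0 : 0 <= a + b := addr_ge0 a0 b0.
rewrite /code_pole_order.
apply: bigmax_le => // A _; apply: bigmax_le => // B _.
apply: bigmax_le => // k _; apply: bigmax_le => // l _.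
rewrite pole_order_leP // mxE; apply: val_at_sum_ge => x _.
rewrite opprD val_atM_ge // ?code_fE ?code_gE; apply: val_at_sum_ge => i _.
  by rewrite -[- a]addr0 val_atM_ge -?pole_order_leP // val_at_const_ge0.
by rewrite -[- b]addr0 val_atM_ge -?pole_order_leP // val_at_const_ge0.
Qed.

End Code.

(** * The code built from the powers of [z1] and [z2] *)

Section FriendlyCode.
Variables (K : finFieldType) (F : functionFieldType K) (m n : nat).
Variables (Q : place F) (z1 z2 : F).
Hypotheses (m_gt1 : (1 < m)%N) (n_gt0 : (0 < n)%N).
Hypothesis Fmn : friendly m n Q z1 z2.

Let m_gt0 : (0 < m)%N := ltnW m_gt1.
Let f (i : 'I_m) : F := z1 ^+ i.
Let g (j : 'I_n) : F := z2 ^+ j.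

Let Qz1 : Q z1 = 1%E. Proof. by case: Fmn. Qed.

(** The prescribed degree is positive, so the pole divisor is nonzero and is not the default value
    for infinite supports. For [z2] the coefficient [m] at [Q] plays the same part. *)
Let coeff_z1 P : coeff P (pole_divisor z1) = pole_order P z1.
Proof.
apply: coeff_pole_divisor; case: Fmn => _ _ deg1 _.
apply: contra_eqN deg1 => /eqP ->.
by rewrite /divisor_degree dom0 big_nil addn1.
Qed.

Let coeff_z2 P : coeff P (pole_divisor z2) = pole_order P z2.
Proof.
apply: coeff_pole_divisor; case: Fmn => _ _ _ ->.
apply/eqP => /(congr1 (coeff Q)); rewrite coeff0 coeffU eqxx mulr1.
by case: (m) m_gt0.
Qed.

Let pole_z2 P : pole_order P z2 = m%:Z * (Q == P)%:R.
Proof. by rewrite -coeff_z2; case: Fmn => _ _ _ ->; rewrite coeffU. Qed.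

Let z1_neq0 : z1 != 0.
Proof. by apply/eqP => z10; move: Qz1; rewrite z10 val_at0. Qed.

Let z2_neq0 : z2 != 0.
Proof.
apply/eqP => z20; have := pole_z2 Q; rewrite eqxx mulr1 z20.
by rewrite /pole_order val_at0 /=; case: (m) m_gt0.
Qed.

Let Qz2 : Q z2 = (- m%:Z)%:E.
Proof.
have [a Qa] := val_at_fin Q z2_neq0; have := pole_z2 Q.
rewrite (pole_orderE Qa) eqxx mulr1 Qa; case: leP => _ eqm.
  by rewrite -eqm opprK.
by case: (m) m_gt0 eqm.
Qed.

Let Qf i : Q (f i) = i%:Z%:E.
Proof. by rewrite (val_atX _ Qz1) -natz. Qed.

Let Qg j : Q (g j) = (- (m * j)%N%:Z)%:E.
Proof. by rewrite (val_atX _ Qz2) mulNrn PoszM -mulr_natr natz. Qed.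

Let Qfg i j : Q (f i * g j) = (i%:Z - (m * j)%N%:Z)%:E.
Proof. by rewrite val_atM Qf Qg. Qed.

Lemma friendly_distinct_valuations : distinct_valuations Q f g.
Proof.
move=> i j i' j' neq; rewrite !Qfg => -[] /eqP.
(* Without subtractions the equality reads [i' + m * j = i + m * j'] in [nat]; as [i] and [i'] are
   below [m], quotients by [m] give [j = j']. *)
rewrite subr_eq addrAC eq_sym subr_eq -!PoszD eqz_nat => /eqP eq_ij.
have jj' : j = j' :> nat.
  have := congr1 (fun u => u %/ m)%N eq_ij.
  rewrite ![(_ + m * _)%N]addnC ![(m * _)%N]mulnC !divnMDl //.
  by rewrite !divn_small // !addn0.
case: neq; congr pair; apply: val_inj => //=.
by move: eq_ij; rewrite jj' => /addIn.
Qed.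

Lemma friendly_polynomial_AG_code : polynomial_AG_code Q f g.
Proof.
have f0 i : f i != 0 by rewrite expf_neq0.
have g0 j : g j != 0 by rewrite expf_neq0.
split; last exact: friendly_distinct_valuations.
(* One divisor serves both families: its coefficients dominate the pole orders of [z1] and of [z2],
   so its [k]-th multiple bounds the poles of their [k]-th powers. *)
- exists (pole_divisor z1 + pole_divisor z2).
  have infty z k :
      (forall P, pole_order P z <= pole_order P z1 + pole_order P z2) ->
      riemann_roch_infty (pole_divisor z1 + pole_divisor z2) (z ^+ k).
    move=> zle; exists k => P; rewrite coeffMn coeffD coeff_z1 coeff_z2.
    rewrite -pole_order_leP ?mulrn_wge0 ?addr_ge0 ?pole_order_ge0 //.
    by apply: le_trans (pole_order_exp_le _ _ _) _; rewrite lerMn2r zle orbT.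
  by split=> i; apply: infty => P; rewrite ?lerDl ?lerDr pole_order_ge0.
(* The valuations at [Q] are [i] for the first family and [- m j] for the second, pairwise distinct
   in each. *)
- apply: (@val_inj_linearly_independent _ _ Q) => // i i' /=.
  by rewrite !Qf => -[] /val_inj.
- apply: (@val_inj_linearly_independent _ _ Q) => // j j' /=.
  rewrite !Qg => -[] /oppr_inj [] /eqP; rewrite eqn_pmul2l // => /eqP.
  exact: val_inj.
Qed.

Variables (r s t : nat) (mr : (m %| r)%N) (nt : (n %| t)%N).
Hypotheses (r_gt0 : (0 < r)%N) (s_gt0 : (0 < s)%N) (t_gt0 : (0 < t)%N).

(* At Q the maximum is attained by f_1 g_n, at any other place by f_m g_1. *)
Lemma friendly_code_pole_order P :
  code_pole_order s mr nt f g P =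
    pole_order P z1 *+ m.-1 + pole_order P z2 *+ n.-1.
Proof.
have pow_le z (d : nat) (i : 'I_d) :
    pole_order P (z ^+ i) <= pole_order P z *+ d.-1.
  apply: le_trans (pole_order_exp_le _ _ _) _.
  rewrite ler_wpMn2l ?pole_order_ge0 //.
  by case: d i => [[]|d i] //=; rewrite -ltnS.
apply/eqP; rewrite eq_le; apply/andP; split.
  apply: code_pole_order_le; first 2 last.
  - by move=> i; exact: pow_le.
  - by move=> j; exact: pow_le.
  - by rewrite mulrn_wge0 ?pole_order_ge0.
  - by rewrite mulrn_wge0 ?pole_order_ge0.
have le_code := pole_order_le_code mr nt f g r_gt0 s_gt0 t_gt0.
have [QP|/negbTE QP] := eqVneq Q P.
  have n1 : (n.-1 < n)%N by rewrite prednK.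
  apply: le_trans (le_code P (Ordinal m_gt0) (Ordinal n1)).
  rewrite -QP (pole_orderE Qz1) pole_z2 eqxx mulr1 mul0rn add0r.
  rewrite (pole_orderE (Qfg _ _)) /= sub0r opprK le_max.
  by rewrite PoszM -mulr_natr natz lexx orbT.
have m1 : (m.-1 < m)%N by rewrite prednK.
apply: le_trans (le_code P (Ordinal m1) (Ordinal n_gt0)).
rewrite pole_z2 QP mulr0 mul0rn addr0 /f /g expr0 mulr1 /=.
have [a Pa] := val_at_fin P z1_neq0.
rewrite (pole_orderE Pa) (pole_orderE (val_atX _ Pa)) -mulNrn.
by case: (leP 0 (- a)) => _; rewrite le_max ?mul0rn lexx ?orbT.
Qed.

Lemma friendly_recovery_threshold : place_degree Q = 1%N ->
  recovery_threshold s mr nt f g = (genus F + m * n)%N%:Z.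
Proof.
move=> degQ; rewrite /recovery_threshold /code_pole_divisor.
pose D := pole_divisor z1 *+ m.-1 + pole_divisor z2 *+ n.-1.
(* The placewise equality of orders identifies the code's pole divisor with [D], whose degree is
   additive. *)
rewrite (@fsum_divisorE _ _ _ D); last first.
  move=> P; rewrite coeffD !coeffMn coeff_z1 coeff_z2.
  exact: friendly_code_pole_order.
rewrite {}/D divisor_degreeD !divisor_degreeMn.
case: Fmn => m1g _ -> ->; rewrite divisor_degreeU degQ mulr1.
have natMn (a k : nat) : a%:Z *+ k = (a * k)%N%:Z.
  by rewrite -mulr_natr natz PoszM.
rewrite !natMn -!PoszD; congr Posz.
(* As [m - 1] divides the genus, the first term is exactly [genus + (m - 1)]; this [m - 1] and the
   final 1 of the threshold complete [m (n - 1)] to [m n]. *)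
rewrite mulnDl divnK // mul1n.
have -> : (m * n.-1 = m * n - m)%N by rewrite -subn1 mulnBr muln1.
rewrite -addnA -addnA; congr (_ + _)%N.
by rewrite addnCA addn1 prednK // subnK // leq_pmulr.
Qed.

End FriendlyCode.

Theorem theorem3p1 (K : finFieldType) (F : functionFieldType K)
    (m n r s t : nat) (m_gt1 : (1 < m)%N) (n_gt0 : (0 < n)%N)
    (r_gt0 : (0 < r)%N) (s_gt0 : (0 < s)%N) (t_gt0 : (0 < t)%N)
    (mr : (m %| r)%N) (nt : (n %| t)%N)
    (Q : place F) (z1 z2 : F) (Fmn : friendly m n Q z1 z2) :
  let f := fun i : 'I_m => z1 ^+ i in
  let g := fun j : 'I_n => z2 ^+ j in
  [/\ distinct_valuations Q f g,
      polynomial_AG_code Q f g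
    & place_degree Q = 1%N ->
      recovery_threshold s mr nt f g = (genus F + m * n)%N%:Z].
Proof.
split.
- exact: (friendly_distinct_valuations m_gt1 Fmn).
- exact: (friendly_polynomial_AG_code m_gt1 Fmn).
- exact: (friendly_recovery_threshold m_gt1 n_gt0 Fmn).
Qed.
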